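(* Let $\mathbb{C}$ be a finitely complete $\mathsf{Ord}$-enriched category which admits comma objects and $2$-pullbacks. The following statements are equivalent: (i) The horizontal comma object functor $H_{\alpha}\colon \mathsf{Pt}_Y(\mathbb{C})\to \mathsf{Pt}_A(\mathbb{C})$ is conservative for every morphism $\alpha\colon A\to Y$ of $\mathbb{C}$. (ii) For all morphisms $\alpha\colon A\to Y$, $\beta\colon Y\to V$, $f\colon X\to Y$, $s\colon Y\to X$, $g\colon U\to V$, $t\colon V\to U$, $\chi\colon X\to U$ of $\mathbb{C}$ with $fs=1_Y$, $gt=1_V$, $\beta f=g\chi$ and $\chi s=t\beta$, and with $(f/\alpha,\pi_1\colon f/\alpha\to X,\pi_2\colon f/\alpha\to A)$ the comma object of $(f,\alpha)$ (regarded as a point over $A$ via $\pi_2$ and its section $i_2=\langle s\alpha,1_A\rangle$): if $(f/\alpha,\ \chi\pi_1,\ \pi_2)$ is a comma object of $(g,\beta\alpha)$, then the commutative square $\beta f=g\chi$ is a $2$-pullback, i.e. $(X,\chi,f)$ is a $2$-pullback of $(g,\beta)$.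
   Context: $\mathsf{Ord}$ is the category of preordered sets (reflexive, transitive relations) and monotone maps. An $\mathsf{Ord}$-enriched category $\mathbb{C}$ is a category whose hom-sets $\mathbb{C}(X,Y)$ carry a preorder $\preccurlyeq$ preserved by pre- and postcomposition. ''Finitely complete'' means that it has finite limits. Comma object of an ordered pair $(f\colon X\to Y,\ g\colon Z\to Y)$: an object $f/g$ with morphisms $\pi_1\colon f/g\to X$, $\pi_2\colon f/g\to Z$ such that (C1) $f\pi_1\preccurlyeq g\pi_2$; (C2) for all $a\colon A\to X$, $b\colon A\to Z$ with $fa\preccurlyeq gb$ there is a unique $\lambda=\langle a,b\rangle\colon A\to f/g$ with $\pi_1\lambda=a$, $\pi_2\lambda=b$; (C3) if $fa\preccurlyeq gb$, $fa'\preccurlyeq gb'$, $a\preccurlyeq a'$ and $b\preccurlyeq b'$, then $\langle a,b\rangle\preccurlyeq\langle a',b'\rangle$. ''$\mathbb{C}$ admits comma objects'' means that every such pair has one. A $2$-pullback of $(f\colon X\to Y,g\colon Z\to Y)$ is a pullback $(P,p_1\colon P\to X,p_2\colon P\to Z)$ such that, for $u,v\colon A\to P$, $p_1u\preccurlyeq p_1v$ and $p_2u\preccurlyeq p_2v$ imply $u\preccurlyeq v$. A point over $Y$ is a pair $(f\colon X\to Y,\ s\colon Y\to X)$ with $fs=1_Y$. $\mathsf{Pt}_Y(\mathbb{C})$ is the category of points over $Y$; a morphism $\gamma\colon(g\colon Z\to Y,t)\to(f\colon X\to Y,s)$ is a morphism $\gamma\colon Z\to X$ with $f\gamma=g$ and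 $\gamma t=s$. For $\alpha\colon A\to Y$, the horizontal comma object change-of-base functor $H_\alpha\colon\mathsf{Pt}_Y(\mathbb{C})\to\mathsf{Pt}_A(\mathbb{C})$ sends $(f,s)$ to the point $(\pi_2\colon f/\alpha\to A,\ \langle s\alpha,1_A\rangle\colon A\to f/\alpha)$, where $(f/\alpha,\pi_1,\pi_2)$ is the comma object of $(f,\alpha)$, and sends $\gamma\colon(g,t)\to(f,s)$ to the morphism $g/\alpha\to f/\alpha$ induced by the universal property, namely $\langle\gamma\rho_1,\rho_2\rangle$ with $\rho_1,\rho_2$ the projections of $g/\alpha$. A functor is conservative if it reflects isomorphisms. *)

(* Defs.v *)
From mathcomp Require Import all_boot.
From mathcomp Require Import boolp classical_sets functions cardinality.

Set Implicit Arguments.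
Unset Strict Implicit.
Unset Printing Implicit Defensive.

Declare Scope cat_scope.
Delimit Scope cat_scope with cat.
Local Open Scope classical_set_scope.
Local Open Scope cat_scope.

Reserved Notation "g ∘ f" (at level 40, left associativity).
Reserved Notation "f ≼ g" (at level 70, no associativity).

(* Morphisms are compared by Leibniz equality. *)
Record category := Category {
  ob :> Type;
  hom : ob -> ob -> Type;
  idm : forall X, hom X X;
  catcomp : forall X Y Z, hom Y Z -> hom X Y -> hom X Z;
  catcomp_idl : forall X Y (f : hom X Y), catcomp (idm Y) f = f;
  catcomp_idr : forall X Y (f : hom X Y), catcomp f (idm X) = f;
  catcompA : forall W X Y Z (h : hom Y Z) (g : hom X Y) (f : hom W X),
    catcomp h (catcomp g f) = catcomp (catcomp h g) f
}.
Arguments hom {c} X Y.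
Arguments idm {c} X.
Arguments catcomp {c X Y Z} g f.
Notation "g ∘ f" := (catcomp g f) : cat_scope.

Definition is_iso (C : category) (X Y : C) (f : hom X Y) : Prop :=
  exists g : hom Y X, g ∘ f = idm X /\ f ∘ g = idm Y.

Record functor (C D : category) := Functor {
  fob :> C -> D;
  fhom : forall X Y : C, hom X Y -> hom (fob X) (fob Y);
  fhom_id : forall X : C, fhom (idm X) = idm (fob X);
  fhom_comp : forall (X Y Z : C) (g : hom Y Z) (f : hom X Y),
    fhom (g ∘ f) = fhom g ∘ fhom f
}.
Arguments fhom {C D} F {X Y} f : rename.

Definition conservative (C D : category) (F : functor C D) : Prop :=
  forall (X Y : C) (f : hom X Y), is_iso (fhom F f) -> is_iso f.

Definition finite_category (J : category) : Prop :=
  finite_set [set: ob J] /\ forall i j : J, finite_set [set: hom i j].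

Definition is_cone (J C : category) (D : functor J C) (L : C)
    (p : forall j : J, hom L (D j)) : Prop :=
  forall (i j : J) (u : hom i j), fhom D u ∘ p i = p j.

Definition is_limit (J C : category) (D : functor J C) (L : C)
    (p : forall j : J, hom L (D j)) : Prop :=
  is_cone p /\
  forall (A : C) (a : forall j : J, hom A (D j)), is_cone a ->
    exists! l : hom A L, forall j, p j ∘ l = a j.

Definition finitely_complete (C : category) : Prop :=
  forall (J : category) (D : functor J C), finite_category J ->
    exists (L : C) (p : forall j : J, hom L (D j)), is_limit p.

(* [hle] is only a preorder: [f ≼ g] and [g ≼ f] do not force [f = g]. *)
Record ord_category := OrdCategory {
  ord_base :> category;
  hle : forall X Y : ord_base, hom X Y -> hom X Y -> Prop;
  hle_refl : forall (X Y : ord_base) (f : hom X Y), hle f f;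
  hle_trans : forall (X Y : ord_base) (f g h : hom X Y),
    hle f g -> hle g h -> hle f h;
  hle_compl : forall (X Y Z : ord_base) (h : hom Y Z) (f g : hom X Y),
    hle f g -> hle (h ∘ f) (h ∘ g);
  hle_compr : forall (X Y Z : ord_base) (f g : hom Y Z) (h : hom X Y),
    hle f g -> hle (f ∘ h) (g ∘ h)
}.
Arguments hle {o X Y} f g.
Notation "f ≼ g" := (hle f g) : cat_scope.

Record is_comma (C : ord_category) (X Y Z : C) (f : hom X Y) (g : hom Z Y)
    (P : C) (p1 : hom P X) (p2 : hom P Z) : Prop := IsComma {
  comma_le : f ∘ p1 ≼ g ∘ p2;
  comma_univ : forall (A : C) (a : hom A X) (b : hom A Z), f ∘ a ≼ g ∘ b ->
    exists! l : hom A P, p1 ∘ l = a /\ p2 ∘ l = b;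
  (* [l] and [l'] are the morphisms <a, b> and <a', b'> of [comma_univ]. *)
  comma_mono : forall (A : C) (a a' : hom A X) (b b' : hom A Z),
    f ∘ a ≼ g ∘ b -> f ∘ a' ≼ g ∘ b' -> a ≼ a' -> b ≼ b' ->
    forall l l' : hom A P,
      p1 ∘ l = a /\ p2 ∘ l = b -> p1 ∘ l' = a' /\ p2 ∘ l' = b' -> l ≼ l'
}.

Record comma (C : ord_category) (X Y Z : C) (f : hom X Y) (g : hom Z Y) :=
  Comma {
  comma_ob :> C;
  comma_p1 : hom comma_ob X;
  comma_p2 : hom comma_ob Z;
  commaP : is_comma f g comma_p1 comma_p2
}.
Arguments comma_p1 {C X Y Z f g} c.
Arguments comma_p2 {C X Y Z f g} c.

(* A choice of a comma object for every cospan. *)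
Definition has_commas (C : ord_category) : Type :=
  forall (X Y Z : C) (f : hom X Y) (g : hom Z Y), comma f g.

Lemma comma_pair_ex (C : ord_category) (X Y Z : C) (f : hom X Y) (g : hom Z Y)
    (P : comma f g) (A : C) (a : hom A X) (b : hom A Z) :
  f ∘ a ≼ g ∘ b ->
  exists l : hom A P, comma_p1 P ∘ l = a /\ comma_p2 P ∘ l = b.
Proof. by move=> /(comma_univ (commaP P)) [l [Hl _]]; exists l. Qed.

Definition comma_pair (C : ord_category) (X Y Z : C) (f : hom X Y)
    (g : hom Z Y) (P : comma f g) (A : C) (a : hom A X) (b : hom A Z)
    (le_ab : f ∘ a ≼ g ∘ b) : hom A P :=
  projT1 (cid (comma_pair_ex P le_ab)).

Lemma comma_pairE (C : ord_category) (X Y Z : C) (f : hom X Y) (g : hom Z Y)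
    (P : comma f g) (A : C) (a : hom A X) (b : hom A Z)
    (le_ab : f ∘ a ≼ g ∘ b) :
  comma_p1 P ∘ comma_pair P le_ab = a /\ comma_p2 P ∘ comma_pair P le_ab = b.
Proof. exact: (projT2 (cid (comma_pair_ex P le_ab))). Qed.

Lemma comma_ext (C : ord_category) (X Y Z : C) (f : hom X Y) (g : hom Z Y)
    (P : comma f g) (A : C) (l l' : hom A P) :
  comma_p1 P ∘ l = comma_p1 P ∘ l' -> comma_p2 P ∘ l = comma_p2 P ∘ l' ->
  l = l'.
Proof.
move=> e1 e2.
have le_l : f ∘ (comma_p1 P ∘ l') ≼ g ∘ (comma_p2 P ∘ l').
  by rewrite !catcompA; apply/hle_compr/(comma_le (commaP P)).
have [m [_ mu]] := comma_univ (commaP P) le_l.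
by rewrite -(mu l) // -(mu l').
Qed.

Definition is_pullback (C : category) (X Y Z : C) (f : hom X Y) (g : hom Z Y)
    (P : C) (p1 : hom P X) (p2 : hom P Z) : Prop :=
  f ∘ p1 = g ∘ p2 /\
  forall (A : C) (a : hom A X) (b : hom A Z), f ∘ a = g ∘ b ->
    exists! l : hom A P, p1 ∘ l = a /\ p2 ∘ l = b.

Definition is_2pullback (C : ord_category) (X Y Z : C) (f : hom X Y)
    (g : hom Z Y) (P : C) (p1 : hom P X) (p2 : hom P Z) : Prop :=
  is_pullback f g p1 p2 /\
  forall (A : C) (u v : hom A P), p1 ∘ u ≼ p1 ∘ v -> p2 ∘ u ≼ p2 ∘ v -> u ≼ v.

Definition has_2pullbacks (C : ord_category) : Prop :=
  forall (X Y Z : C) (f : hom X Y) (g : hom Z Y),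
    exists (P : C) (p1 : hom P X) (p2 : hom P Z), is_2pullback f g p1 p2.

Record point (C : category) (Y : C) := Point {
  pt_ob : C;
  pt_proj : hom pt_ob Y;
  pt_sec : hom Y pt_ob;
  pt_projK : pt_proj ∘ pt_sec = idm Y
}.

Record point_hom (C : category) (Y : C) (p q : point Y) := PointHom {
  pt_mor :> hom (pt_ob p) (pt_ob q);
  pt_mor_proj : pt_proj q ∘ pt_mor = pt_proj p;
  pt_mor_sec : pt_mor ∘ pt_sec p = pt_sec q
}.

Lemma point_hom_inj (C : category) (Y : C) (p q : point Y)
    (u v : point_hom p q) : pt_mor u = pt_mor v -> u = v.
Proof.
case: u v => [u pu su] [v pv sv] /= e; subst v.
by rewrite (Prop_irrelevance pu pv) (Prop_irrelevance su sv).
Qed.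

Definition point_id (C : category) (Y : C) (p : point Y) : point_hom p p :=
  PointHom (catcomp_idr (pt_proj p)) (catcomp_idl (pt_sec p)).

Lemma point_comp_proj (C : category) (Y : C) (p q r : point Y)
    (v : point_hom q r) (u : point_hom p q) :
  pt_proj r ∘ (v ∘ u) = pt_proj p.
Proof. by rewrite catcompA !pt_mor_proj. Qed.

Lemma point_comp_sec (C : category) (Y : C) (p q r : point Y)
    (v : point_hom q r) (u : point_hom p q) :
  (v ∘ u) ∘ pt_sec p = pt_sec r.
Proof. by rewrite -catcompA !pt_mor_sec. Qed.

Definition point_comp (C : category) (Y : C) (p q r : point Y)
    (v : point_hom q r) (u : point_hom p q) : point_hom p r :=
  PointHom (point_comp_proj v u) (point_comp_sec v u).

Lemma point_comp_idl (C : category) (Y : C) (p q : point Y)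
    (u : point_hom p q) : point_comp (point_id q) u = u.
Proof. by apply: point_hom_inj; rewrite /= catcomp_idl. Qed.

Lemma point_comp_idr (C : category) (Y : C) (p q : point Y)
    (u : point_hom p q) : point_comp u (point_id p) = u.
Proof. by apply: point_hom_inj; rewrite /= catcomp_idr. Qed.

Lemma point_compA (C : category) (Y : C) (o p q r : point Y)
    (w : point_hom q r) (v : point_hom p q) (u : point_hom o p) :
  point_comp w (point_comp v u) = point_comp (point_comp w v) u.
Proof. by apply: point_hom_inj; rewrite /= catcompA. Qed.

Definition Pt (C : category) (Y : C) : category :=
  Category (@point_comp_idl C Y) (@point_comp_idr C Y) (@point_compA C Y).

Lemma hcomma_sec_le (C : ord_category) (A Y : C) (alpha : hom A Y)
    (p : Pt Y) :
  pt_proj p ∘ (pt_sec p ∘ alpha) ≼ alpha ∘ idm A.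
Proof. by rewrite catcompA pt_projK catcomp_idl catcomp_idr; apply: hle_refl. Qed.

Definition hcomma_sec (C : ord_category) (cm : has_commas C) (A Y : C)
    (alpha : hom A Y) (p : Pt Y) : hom A (cm _ _ _ (pt_proj p) alpha) :=
  comma_pair (cm _ _ _ (pt_proj p) alpha) (hcomma_sec_le alpha p).

Definition hcomma_ob (C : ord_category) (cm : has_commas C) (A Y : C)
    (alpha : hom A Y) (p : Pt Y) : Pt A :=
  Point (proj2 (comma_pairE (cm _ _ _ (pt_proj p) alpha) (hcomma_sec_le alpha p))
         : comma_p2 (cm _ _ _ (pt_proj p) alpha) ∘ hcomma_sec cm alpha p = idm A).

Lemma hcomma_mor_le (C : ord_category) (cm : has_commas C) (A Y : C)
    (alpha : hom A Y) (p q : Pt Y) (gamma : hom p q) :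
  pt_proj q ∘ (pt_mor gamma ∘ comma_p1 (cm _ _ _ (pt_proj p) alpha))
    ≼ alpha ∘ comma_p2 (cm _ _ _ (pt_proj p) alpha).
Proof. by rewrite catcompA pt_mor_proj; exact: (comma_le (commaP _)). Qed.

Definition hcomma_mor (C : ord_category) (cm : has_commas C) (A Y : C)
    (alpha : hom A Y) (p q : Pt Y) (gamma : hom p q) :
    hom (pt_ob (hcomma_ob cm alpha p)) (pt_ob (hcomma_ob cm alpha q)) :=
  comma_pair (cm _ _ _ (pt_proj q) alpha) (hcomma_mor_le cm alpha gamma).

Lemma hcomma_mor_proj (C : ord_category) (cm : has_commas C) (A Y : C)
    (alpha : hom A Y) (p q : Pt Y) (gamma : hom p q) :
  pt_proj (hcomma_ob cm alpha q) ∘ hcomma_mor cm alpha gamma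
    = pt_proj (hcomma_ob cm alpha p).
Proof. exact: (proj2 (comma_pairE _ (hcomma_mor_le cm alpha gamma))). Qed.

Lemma hcomma_mor_sec (C : ord_category) (cm : has_commas C) (A Y : C)
    (alpha : hom A Y) (p q : Pt Y) (gamma : hom p q) :
  hcomma_mor cm alpha gamma ∘ pt_sec (hcomma_ob cm alpha p)
    = pt_sec (hcomma_ob cm alpha q).
Proof.
have [m1 m2] := comma_pairE (cm _ _ _ (pt_proj q) alpha)
  (hcomma_mor_le cm alpha gamma).
have [p1 p2] := comma_pairE (cm _ _ _ (pt_proj p) alpha) (hcomma_sec_le alpha p).
have [q1 q2] := comma_pairE (cm _ _ _ (pt_proj q) alpha) (hcomma_sec_le alpha q).
apply: comma_ext; rewrite /= /hcomma_sec /hcomma_mor catcompA.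
  by rewrite m1 -catcompA p1 q1 catcompA pt_mor_sec.
by rewrite m2 p2 q2.
Qed.

Definition hcomma_hom (C : ord_category) (cm : has_commas C) (A Y : C)
    (alpha : hom A Y) (p q : Pt Y) (gamma : hom p q) :
    @hom (Pt A) (hcomma_ob cm alpha p) (hcomma_ob cm alpha q) :=
  @PointHom C A (hcomma_ob cm alpha p) (hcomma_ob cm alpha q)
    (hcomma_mor cm alpha gamma)
    (hcomma_mor_proj cm alpha gamma)
    (hcomma_mor_sec cm alpha gamma).

Lemma hcomma_hom_id (C : ord_category) (cm : has_commas C) (A Y : C)
    (alpha : hom A Y) (p : Pt Y) :
  hcomma_hom cm alpha (idm p) = idm (hcomma_ob cm alpha p).
Proof.
have [m1 m2] := comma_pairE (cm _ _ _ (pt_proj p) alpha)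
  (hcomma_mor_le cm alpha (idm p)).
apply: point_hom_inj; apply: comma_ext; rewrite /= /hcomma_mor catcomp_idr.
  by rewrite m1 catcomp_idl.
by rewrite m2.
Qed.

Lemma hcomma_hom_comp (C : ord_category) (cm : has_commas C) (A Y : C)
    (alpha : hom A Y) (p q r : Pt Y) (v : hom q r) (u : hom p q) :
  hcomma_hom cm alpha (v ∘ u) = hcomma_hom cm alpha v ∘ hcomma_hom cm alpha u.
Proof.
have [m1 m2] := comma_pairE (cm _ _ _ (pt_proj r) alpha)
  (hcomma_mor_le cm alpha (v ∘ u)).
have [v1 v2] := comma_pairE (cm _ _ _ (pt_proj r) alpha)
  (hcomma_mor_le cm alpha v).
have [u1 u2] := comma_pairE (cm _ _ _ (pt_proj q) alpha)
  (hcomma_mor_le cm alpha u).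
apply: point_hom_inj; apply: comma_ext; rewrite /= /hcomma_mor catcompA.
  by rewrite m1 v1 -catcompA u1 catcompA.
by rewrite m2 v2 u2.
Qed.

Definition hcomma (C : ord_category) (cm : has_commas C) (A Y : C)
    (alpha : hom A Y) : functor (Pt Y) (Pt A) :=
  Functor (hcomma_hom_id cm alpha) (@hcomma_hom_comp C cm A Y alpha).

(* Main.v *)
Require Import Defs.
From mathcomp Require Import all_boot.

Set Implicit Arguments.
Unset Strict Implicit.
Unset Printing Implicit Defensive.

Local Open Scope cat_scope.

(** Both directions compare a point with its image under the functor [H_alpha]
    through the fact that being a comma object or a 2-pullback is invariant
    under isomorphism.

    From (i) to (ii), let [Q] be a 2-pullback of [(g, beta)], seen as a point
    over [Y] with section [<t beta, 1>].  The square induces a morphism of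
    points [gamma = <chi, f> : X -> Q], and it is enough to show that
    [H_alpha gamma : f/alpha -> q2/alpha] is invertible.  As [f/alpha] is also
    a comma object of [(g, beta alpha)], the projections of [q2/alpha] induce a
    morphism [lambda : q2/alpha -> f/alpha], and [lambda] is a retraction of
    [H_alpha gamma] by uniqueness.  That it is also a section amounts to
    [f pi1 lambda = q2 rho1], an equality that a priori holds only after
    composition with [beta], both sides being below [alpha rho2].  This is where
    the sections enter: applying the uniqueness of [g/(beta alpha)] to pairs of
    the form [(t beta y, b)] shows that [beta] can be cancelled between
    morphisms lying below [alpha b] ([comma_section_cancel]).

    From (ii) to (i), a morphism of points [gamma : p -> q] over [Y] is a square
    of split epimorphisms over [beta = 1].  If [H_alpha gamma] is invertible
    then the comma object of [p] is also one of [q], so by (ii) [gamma] is a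
    pullback of an identity, hence invertible. *)

Section PointIsomorphisms.
Variables (C : category) (Y : C) (p q : Pt Y).

Lemma is_iso_pt_mor (u : hom p q) : is_iso u -> is_iso (pt_mor u).
Proof.
by case=> v [vu uv]; exists (pt_mor v); split;
  [have := congr1 (@pt_mor _ _ _ _) vu | have := congr1 (@pt_mor _ _ _ _) uv].
Qed.

(** The inverse of the underlying morphism automatically respects projections
    and sections. *)
Lemma is_iso_of_pt_mor (u : hom p q) : is_iso (pt_mor u) -> is_iso u.
Proof.
case=> v [vu uv].
have v_proj : pt_proj p ∘ v = pt_proj q.
  by rewrite -(pt_mor_proj u) -catcompA uv catcomp_idr.
have v_sec : v ∘ pt_sec q = pt_sec p.
  by rewrite -(pt_mor_sec u) catcompA vu catcomp_idl.
by exists (PointHom v_proj v_sec); split; apply: point_hom_inj.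
Qed.

End PointIsomorphisms.

Lemma is_pullback_idm_iso (C : category) (X Y P : C) (f : hom X Y)
    (p1 : hom P X) (p2 : hom P Y) :
  is_pullback f (idm Y) p1 p2 -> is_iso p1.
Proof.
case=> sq univ.
have sqX : f ∘ idm X = idm Y ∘ f by rewrite catcomp_idr catcomp_idl.
have [k [[k1 k2] _]] := univ _ _ _ sqX.
have [l [_ l_uniq]] := univ _ _ _ sq.
exists k; split=> //.
rewrite -(l_uniq (idm P)) ?catcomp_idr // (l_uniq (k ∘ p1)) //.
by rewrite !catcompA k1 k2 catcomp_idl sq catcomp_idl.
Qed.

Section CommaObjects.
Variable C : ord_category.

Section JointProperties.
Variables (X Y Z P : C) (f : hom X Y) (g : hom Z Y).
Variables (p1 : hom P X) (p2 : hom P Z).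
Hypothesis P_comma : is_comma f g p1 p2.

Lemma is_comma_le_comp (A : C) (l : hom A P) :
  f ∘ (p1 ∘ l) ≼ g ∘ (p2 ∘ l).
Proof. by rewrite !catcompA; apply/hle_compr/(comma_le P_comma). Qed.

Lemma is_comma_ext (A : C) (l l' : hom A P) :
  p1 ∘ l = p1 ∘ l' -> p2 ∘ l = p2 ∘ l' -> l = l'.
Proof.
move=> e1 e2.
have [m [_ m_uniq]] := comma_univ P_comma (is_comma_le_comp l').
by rewrite -(m_uniq l) // -(m_uniq l').
Qed.

Lemma is_comma_reflect_le (A : C) (l l' : hom A P) :
  p1 ∘ l ≼ p1 ∘ l' -> p2 ∘ l ≼ p2 ∘ l' -> l ≼ l'.
Proof.
move=> le1 le2.
by apply: (comma_mono P_comma _ _ le1 le2); first exact: is_comma_le_comp;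
  first exact: is_comma_le_comp.
Qed.

Lemma is_comma_iso (Q : C) (m : hom Q P) :
  is_iso m -> is_comma f g (p1 ∘ m) (p2 ∘ m).
Proof.
case=> n [nm mn]; split.
- exact: is_comma_le_comp.
- move=> A a b le_ab; have [l [[l1 l2] l_uniq]] := comma_univ P_comma le_ab.
  exists (n ∘ l); split.
    by rewrite -!catcompA [m ∘ _]catcompA mn catcomp_idl.
  move=> k [k1 k2]; rewrite (l_uniq (m ∘ k)) ?catcompA //.
  by rewrite nm catcomp_idl.
- move=> A a a' b b' _ _ le_a le_b l l' [l1 l2] [l1' l2'].
  have le_m : m ∘ l ≼ m ∘ l'.
    by apply: is_comma_reflect_le; rewrite !catcompA ?l1 ?l1' ?l2 ?l2'.
  by have := hle_compl n le_m; rewrite !catcompA nm !catcomp_idl.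
Qed.

End JointProperties.

Lemma is_2pullback_iso (X Y Z P Q : C) (f : hom X Y) (g : hom Z Y)
    (p1 : hom P X) (p2 : hom P Z) (m : hom Q P) :
  is_2pullback f g p1 p2 -> is_iso m ->
  is_2pullback f g (p1 ∘ m) (p2 ∘ m).
Proof.
case=> -[sq univ] mono [n [nm mn]]; split; first split.
- by rewrite !catcompA sq.
- move=> A a b eq_ab; have [l [[l1 l2] l_uniq]] := univ _ _ _ eq_ab.
  exists (n ∘ l); split.
    by rewrite -!catcompA [m ∘ _]catcompA mn catcomp_idl.
  move=> k [k1 k2]; rewrite (l_uniq (m ∘ k)) ?catcompA //.
  by rewrite nm catcomp_idl.
- move=> A u v; rewrite -!catcompA => le1 le2.
  by have := hle_compl n (mono _ _ _ le1 le2); rewrite !catcompA nm !catcomp_idl.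
Qed.

Section SplitSquare.
Variables (A Y V X U P : C) (alpha : hom A Y) (beta : hom Y V).
Variables (f : hom X Y) (s : hom Y X) (g : hom U V) (t : hom V U).
Variable chi : hom X U.
Variables (p1 : hom P X) (p2 : hom P A).
Hypotheses (fs : f ∘ s = idm Y) (chis : chi ∘ s = t ∘ beta).
Hypothesis f_comma : is_comma f alpha p1 p2.
Hypothesis g_comma : is_comma g (beta ∘ alpha) (chi ∘ p1) p2.

(** As [chi s y = t beta y] depends on [y] only through [beta y], the morphisms
    [<s y, b>] and [<s y', b>] into [f/alpha] agree for the projections of
    [g/(beta alpha)], hence are equal; [f] then recovers [y] from [s y]. *)
Lemma comma_section_cancel (W : C) (y y' : hom W Y) (b : hom W A) :
  y ≼ alpha ∘ b -> y' ≼ alpha ∘ b -> beta ∘ y = beta ∘ y' -> y = y'.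
Proof.
have lift z : z ≼ alpha ∘ b ->
    exists l : hom W P, p1 ∘ l = s ∘ z /\ p2 ∘ l = b.
  move=> le_z; have le_sz : f ∘ (s ∘ z) ≼ alpha ∘ b.
    by rewrite catcompA fs catcomp_idl.
  by have [l [lE _]] := comma_univ f_comma le_sz; exists l.
move=> /lift[l [l1 l2]] /lift[l' [l1' l2']] eq_beta.
have eq_l : l = l'.
  apply: (is_comma_ext g_comma); last by rewrite l2 l2'.
  by rewrite -!catcompA l1 l1' !catcompA chis -!catcompA eq_beta.
by rewrite -[y]catcomp_idl -[y']catcomp_idl -fs -!catcompA -l1 -l1' eq_l.
Qed.

(** Here [m] plays the role of [H_alpha <chi, f>].  Its inverse [lam] comes
    from the universal property of [P] over [(g, beta alpha)], which controls
    [chi p1 lam] but not [f p1 lam]; the latter is recovered by cancelling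
    [beta], since [f p1 lam] and [q2 r1] both lie below [alpha r2]. *)
Lemma comma_comparison_iso (Q R : C) (q1 : hom Q U) (q2 : hom Q Y)
    (r1 : hom R Q) (r2 : hom R A) (gamma : hom X Q) (m : hom P R) :
  is_pullback g beta q1 q2 -> beta ∘ f = g ∘ chi ->
  is_comma q2 alpha r1 r2 ->
  q1 ∘ gamma = chi -> q2 ∘ gamma = f ->
  r1 ∘ m = gamma ∘ p1 -> r2 ∘ m = p2 ->
  is_iso m.
Proof.
move=> [q_sq q_univ] sq R_comma gamma1 gamma2 m1 m2.
have le_lam : g ∘ (q1 ∘ r1) ≼ (beta ∘ alpha) ∘ r2.
  rewrite catcompA q_sq -!catcompA.
  exact/hle_compl/(comma_le R_comma).
have [lam [[lam1 lam2] _]] := comma_univ g_comma le_lam.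
exists lam; split.
  apply: (is_comma_ext g_comma); rewrite catcomp_idr catcompA.
    by rewrite lam1 -catcompA m1 catcompA gamma1.
  by rewrite lam2 m2.
have f_lam : f ∘ (p1 ∘ lam) = q2 ∘ r1.
  apply: (@comma_section_cancel _ _ _ r2).
  - by rewrite -lam2; apply: is_comma_le_comp f_comma _ _.
  - exact: comma_le R_comma.
  - by rewrite catcompA sq !catcompA -q_sq -!catcompA -lam1 -!catcompA.
apply: (is_comma_ext R_comma); rewrite catcomp_idr catcompA; last first.
  by rewrite m2 lam2.
have sq_r : g ∘ (q1 ∘ r1) = beta ∘ (q2 ∘ r1) by rewrite !catcompA q_sq.
have [k [_ k_uniq]] := q_univ _ _ _ sq_r.
transitivity k; last exact: k_uniq.
apply/esym/k_uniq; rewrite m1; split; rewrite -catcompA catcompA.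
  by rewrite gamma1 catcompA lam1.
by rewrite gamma2 f_lam.
Qed.

End SplitSquare.
End CommaObjects.

Theorem corollary2p6 (C : ord_category) (C_fincomplete : finitely_complete C)
    (cm : has_commas C) (C_2pullbacks : has_2pullbacks C) :
  (forall (A Y : C) (alpha : hom A Y), conservative (hcomma cm alpha))
  <->
  (forall (A Y V X U : C) (alpha : hom A Y) (beta : hom Y V)
      (f : hom X Y) (s : hom Y X) (g : hom U V) (t : hom V U) (chi : hom X U),
    f ∘ s = idm Y -> g ∘ t = idm V ->
    beta ∘ f = g ∘ chi -> chi ∘ s = t ∘ beta ->
    is_comma g (beta ∘ alpha)
      (chi ∘ comma_p1 (cm _ _ _ f alpha)) (comma_p2 (cm _ _ _ f alpha)) ->
    is_2pullback g beta chi f).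
Proof.
split=> [H_cons A Y V X U alpha beta f s g t chi fs gt sq chis g_comma
        | H_2pb A Y alpha p q gamma gamma_iso].
- have [Q [q1 [q2 Q_2pb]]] := C_2pullbacks _ _ _ g beta.
  have [Q_pb _] := Q_2pb; have [_ Q_univ] := Q_pb.
  have [sigma [[sigma1 sigma2] sigma_uniq]] :
      exists! l, q1 ∘ l = t ∘ beta /\ q2 ∘ l = idm Y.
    by apply: Q_univ; rewrite catcompA gt catcomp_idl catcomp_idr.
  have [c [[c1 c2] _]] := Q_univ _ _ _ (esym sq).
  have c_sec : c ∘ s = sigma.
    by rewrite (sigma_uniq (c ∘ s)) // !catcompA c1 c2.
  pose gamma : @hom (Pt Y) (Point fs) (Point sigma2) :=
    @PointHom _ _ (Point fs) (Point sigma2) c c2 c_sec.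
  have c_iso : is_iso c.
    apply: (is_iso_pt_mor (u := gamma)); apply: (H_cons _ _ alpha).
    apply: is_iso_of_pt_mor.
    have [m1 m2] := comma_pairE (cm _ _ _ q2 alpha)
      (hcomma_mor_le cm alpha gamma).
    exact: (comma_comparison_iso fs chis (commaP _) g_comma Q_pb sq
              (commaP _) c1 c2 m1 m2).
  by rewrite -c1 -c2; apply: is_2pullback_iso.
- apply: is_iso_of_pt_mor.
  have [m1 m2] := comma_pairE (cm _ _ _ (pt_proj q) alpha)
    (hcomma_mor_le cm alpha gamma).
  have q_comma : is_comma (pt_proj q) (idm Y ∘ alpha)
      (pt_mor gamma ∘ comma_p1 (cm _ _ _ (pt_proj p) alpha))
      (comma_p2 (cm _ _ _ (pt_proj p) alpha)).
    rewrite catcomp_idl -m1 -[X in is_comma _ _ _ X]m2.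
    apply: (is_comma_iso (commaP _)).
    exact: (is_iso_pt_mor gamma_iso).
  suff [/is_pullback_idm_iso] :
    is_2pullback (pt_proj q) (idm Y) (pt_mor gamma) (pt_proj p) by [].
  apply: H_2pb q_comma; first exact: pt_projK.
  + exact: pt_projK.
  + by rewrite catcomp_idl pt_mor_proj.
  + by rewrite catcomp_idr pt_mor_sec.
Qed.
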